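(* Over fundamental logic, the axiom (Ex) is equivalent to the conjunction of the three axioms (Nu), (Vi), (Cl); that is, a fundamental lattice validates (Ex) if and only if it validates (Nu), (Vi) and (Cl). Hence (Nu), (Vi), (Cl) axiomatize, over fundamental logic, the intersection of orthologic and the implication-free fragment of intuitionistic logic. Moreover this axiomatization is non-redundant: for each of the three axioms, the other two do not imply it over fundamental logic.
   Context: A fundamental lattice is a bounded lattice with a unary $\lnot$ that is antitone, satisfies $a\wedge\lnot a=0$ and $a\le\lnot\lnot a$. An inequality/entailment is valid in $L$ if it holds for all elements (valuations) of $L$. Axioms: (Ex) $\lnot\big[a\wedge((b\wedge c)\vee(b\wedge d))\big]\wedge a\wedge(c\vee e)\wedge\lnot\lnot f \le \lnot\lnot(a\wedge f)\wedge\big[(a\wedge c)\vee(a\wedge e)\vee f\big]\wedge\big[(b\wedge(c\vee d))\vee\lnot(b\wedge(c\vee d))\big]$; (Nu) $\lnot\lnot p\wedge\lnot\lnot q\le\lnot\lnot(p\wedge q)$; (Vi) $a\wedge(c\vee e)\wedge\lnot\lnot f\le(a\wedge c)\vee(a\wedge e)\vee f$; (Cl) $\lnot\big(a\wedge((b\wedge c)\vee(b\wedge d))\big)\wedge a\le(b\wedge(c\vee d))\vee\lnot(b\wedge(c\vee d))$. Formulas use $\wedge,\vee,\lnot,\top,\bot$ only. Orthologic is the set of entailments valid in all ortholattices (fundamental lattices with $\lnot\lnot a=a$); the implication-free fragment of intuitionistic logic is the set valid in all Heyting lattices (distributive fundamental lattices with $a\wedge b=0\Rightarrow b\le\lnot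 a$). A set of axioms $\Gamma$ implies an axiom $\alpha$ over fundamental logic if every fundamental lattice validating $\Gamma$ validates $\alpha$. *)

(* Defs.v *)
From HB Require Import structures.
From mathcomp Require Import all_boot all_order.
From mathcomp Require Import classical_sets.

Set Implicit Arguments.
Unset Strict Implicit.
Unset Printing Implicit Defensive.

Import Order.LTheory.
Local Open Scope order_scope.

HB.mixin Record isFundamental d (L : Type) of Order.TBLattice d L := {
  neg : L -> L;
  neg_antitone : forall a b : L, a <= b -> neg b <= neg a;
  meet_neg : forall a : L, a `&` neg a = \bot;
  le_negneg : forall a : L, a <= neg (neg a) }.

#[short(type="fundLatticeType")]
HB.structure Definition FundLattice d :=
  { L of Order.TBLattice d L & isFundamental d L }.

Inductive formula : Type :=
| Var of nat
| Top
| Bot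
| And of formula & formula
| Or of formula & formula
| Neg of formula.

Declare Scope formula_scope.
Delimit Scope formula_scope with F.
Bind Scope formula_scope with formula.
Notation "p /\ q" := (And p q) : formula_scope.
Notation "p \/ q" := (Or p q) : formula_scope.
Notation "~ p" := (Neg p) : formula_scope.

Section Semantics.
Context {d : Order.disp_t} (L : fundLatticeType d).

Fixpoint eval (v : nat -> L) (p : formula) : L :=
  match p with
  | Var n => v n
  | Top => \top
  | Bot => \bot
  | And p q => eval v p `&` eval v q
  | Or p q => eval v p `|` eval v q
  | Neg p => neg (eval v p)
  end.

(* The pair (p, q) is the entailment of q by p, i.e. the inequality p <= q. *)
Definition entailment : Type := formula * formula.

Definition valid (e : entailment) : Prop :=
  forall v : nat -> L, eval v e.1 <= eval v e.2.

Definition validates (Gamma : set entailment) : Prop :=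
  forall e, Gamma e -> valid e.

Definition ortholattice : Prop := forall a : L, neg (neg a) = a.

Definition heyting_lattice : Prop :=
  (forall a b c : L, a `&` (b `|` c) = (a `&` b) `|` (a `&` c)) /\
  (forall a b : L, a `&` b = \bot -> b <= neg a).

End Semantics.

Definition logic_of (K : forall d, fundLatticeType d -> Prop) : set entailment :=
  [set e | forall d (L : fundLatticeType d), K d L -> valid L e]%classic.

Definition orthologic : set entailment := logic_of (@ortholattice).

Definition intuitionistic_fragment : set entailment :=
  logic_of (@heyting_lattice).

Definition fundamental_logic_with (Gamma : set entailment) : set entailment :=
  logic_of (fun d (L : fundLatticeType d) => validates L Gamma).

Definition fund_implies (Gamma : set entailment) (alpha : entailment) : Prop :=
  forall d (L : fundLatticeType d), validates L Gamma -> valid L alpha.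

Definition axiomatizes (Gamma Lambda : set entailment) : Prop :=
  fundamental_logic_with Gamma = Lambda.

Section NamedEntailments.
Local Open Scope formula_scope.

Let a := Var 0.
Let b := Var 1.
Let c := Var 2.
Let d := Var 3.
Let e := Var 4.
Let f := Var 5.

Definition Ex : entailment :=
  (~ (a /\ ((b /\ c) \/ (b /\ d))) /\ a /\ (c \/ e) /\ ~ ~ f,
   ~ ~ (a /\ f) /\ ((a /\ c) \/ (a /\ e) \/ f)
     /\ ((b /\ (c \/ d)) \/ ~ (b /\ (c \/ d)))).

Definition Nu : entailment := (~ ~ a /\ ~ ~ b, ~ ~ (a /\ b)).

Definition Vi : entailment :=
  (a /\ (c \/ e) /\ ~ ~ f, (a /\ c) \/ (a /\ e) \/ f).

Definition Cl : entailment :=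
  (~ (a /\ ((b /\ c) \/ (b /\ d))) /\ a,
   (b /\ (c \/ d)) \/ ~ (b /\ (c \/ d))).

End NamedEntailments.

(* Main.v *)
(* An ortholattice quotient and a Heyting quotient together separate the points
   of a fundamental lattice L validating Nu, Vi and Cl.  Suppose x is not below
   y.  By Nu the double negation is a homomorphism from L onto the ortholattice
   of its regular elements, and it refutes x <= y unless x <= ~~y.  In that
   case, by Vi, a filter maximal among those containing x and omitting y is
   prime.  By Cl, if F is a prime filter omitting ~a, then a filter maximal
   among the proper ones containing F and a is again prime; hence
   a |-> {F prime | a in F} is a homomorphism from L to the Heyting lattice of
   up-sets of prime filters, and it refutes x <= y. *)
Require Import Defs.
From HB Require Import structures.
From mathcomp Require Import all_boot all_order.
From mathcomp Require Import boolp classical_sets.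

Set Implicit Arguments.
Unset Strict Implicit.
Unset Printing Implicit Defensive.

Import Order.LTheory.
Local Open Scope order_scope.
Local Obligation Tactic := idtac.

(** * Fundamental lattices from an order, operations and their universal properties *)

HB.factory Record Le_isFundamental (d : Order.disp_t) T of Choice T := {
  le : rel T;
  le_refl : reflexive le;
  le_anti : antisymmetric le;
  le_trans : transitive le;
  meet : T -> T -> T;
  join : T -> T -> T;
  bot : T;
  top : T;
  neg : T -> T;
  lexI : forall x y z, le x (meet y z) = le x y && le x z;
  leUx : forall x y z, le (join x y) z = le x z && le y z;
  le0x : forall x, le bot x;
  lex1 : forall x, le x top;
  neg_antitone : forall x y, le x y -> le (neg y) (neg x);
  meet_neg : forall x, meet x (neg x) = bot;
  le_negneg : forall x, le x (neg (neg x)) }.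

HB.builders Context d T of Le_isFundamental d T.
HB.instance Definition _ :=
  Order.Le_isPOrder.Build d T le_refl le_anti le_trans.
HB.instance Definition _ := Order.POrder_MeetJoin_isLattice.Build d T lexI leUx.
HB.instance Definition _ := Order.hasBottom.Build d T le0x.
HB.instance Definition _ := Order.hasTop.Build d T lex1.
HB.instance Definition _ :=
  isFundamental.Build d T neg_antitone meet_neg le_negneg.
HB.end.

(** * Laws of negation, and the axioms as lattice inequalities *)

Section FundamentalLattice.
Context {d : Order.disp_t} {L : fundLatticeType d}.
Implicit Types (a b c x y : L) (p : formula).

Lemma validNuE :
  valid L Nu <-> forall a b, neg (neg a) `&` neg (neg b) <= neg (neg (a `&` b)).
Proof.
split=> [h a b|h v]; last exact: h.
exact: (h (nth \bot [:: a; b])).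
Qed.

Lemma validViE :
  valid L Vi <-> forall a c e f : L,
    a `&` ((c `|` e) `&` neg (neg f)) <= (a `&` c) `|` ((a `&` e) `|` f).
Proof.
split=> [h a c e f|h v]; last exact: h.
(* Entry [i] of the list is the value of [Var i]; [\bot] fills the places of [b] and [d], absent
   from [Vi]. *)
exact: (h (nth \bot [:: a; \bot; c; \bot; e; f])).
Qed.

Lemma validClE :
  valid L Cl <-> forall a b c e : L,
    neg (a `&` ((b `&` c) `|` (b `&` e))) `&` a
      <= (b `&` (c `|` e)) `|` neg (b `&` (c `|` e)).
Proof.
split=> [h a b c e|h v]; last exact: h.
exact: (h (nth \bot [:: a; b; c; e])).
Qed.

Lemma neg1 : neg (\top : L) = \bot.
Proof. by rewrite -(meet_neg \top) meet1x. Qed.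

Lemma neg0 : neg (\bot : L) = \top.
Proof. by apply/eqP; rewrite -le1x -neg1 le_negneg. Qed.

(** [neg] forms an antitone Galois connection with itself; the De Morgan law [negU] follows from
    this. *)
Lemma le_negC a b : (a <= neg b) = (b <= neg a).
Proof.
apply/idP/idP => h; apply: le_trans (le_negneg _) _; exact: neg_antitone.
Qed.

Lemma neg3 a : neg (neg (neg a)) = neg a.
Proof. by apply/le_anti; rewrite le_negneg neg_antitone ?le_negneg. Qed.

Lemma le_negneg_mono a b : a <= b -> neg (neg a) <= neg (neg b).
Proof. by move=> h; do 2 apply: neg_antitone. Qed.

(** Double negation gives the least regular element above [a]. *)
Lemma negneg_le_regular a b :
  neg (neg b) = b -> (neg (neg a) <= b) = (a <= b).
Proof.
move=> rb; apply/idP/idP=> [|h]; first exact: le_trans (le_negneg a).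
by rewrite -rb le_negneg_mono.
Qed.

Lemma negU a b : neg (a `|` b) = neg a `&` neg b.
Proof.
apply/le_anti; rewrite lexI !neg_antitone ?leUl ?leUr //=.
by rewrite le_negC leUx !(le_negC _ (_ `&` _)) leIl leIr.
Qed.

Lemma regularI a b :
  neg (neg a) = a -> neg (neg b) = b -> neg (neg (a `&` b)) = a `&` b.
Proof.
move=> ra rb; apply/le_anti; rewrite le_negneg andbT lexI.
by rewrite !negneg_le_regular // leIl leIr.
Qed.

Lemma validEx :
  valid L Ex <-> [/\ valid L Nu, valid L Vi & valid L Cl].
Proof.
split=> [h | [/validNuE nu /validViE vi /validClE cl] v /=].
  have {}h (a b c e f g : L) := h (nth \bot [:: a; b; c; g; e; f]).
  cbn in h.
  (* A one-sided form of [Nu]: setting [b], [c], [d] to [\bot] and [e] to [\top] leaves only [a] and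
     the double negation of [f] in the premise. *)
  have nu a f : a `&` neg (neg f) <= neg (neg (a `&` f)).
    apply: le_trans (le_trans (h a \bot \bot \top f \bot) _); last exact: leIl.
    by rewrite !(meet0x, joinxx, meetx0, neg0, meet1x, joinx1).
  split.
  - apply/validNuE => a b.
    (* The one-sided form is applied once to each factor; [neg3] absorbs the extra double
       negation. *)
    apply: le_trans (nu _ _) _; rewrite -(neg3 (neg (a `&` b))).
    by do 2 apply: neg_antitone; rewrite meetC [a `&` b]meetC nu.
  - apply/validViE => a c e f.
    (* With [b] equal to [\bot] the negated conjunct becomes [\top]. *)
    apply: le_trans (le_trans (h a \bot c e f \bot) _).
      by rewrite !(meet0x, joinxx, meetx0, neg0, meet1x).
    by rewrite leIx2 // leIl orbT.
  - apply/validClE => a b c e.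
    (* With [e] and [f] equal to [\top] the last two conjuncts of the premise disappear. *)
    apply: le_trans (le_trans (h a b c \top \top e) _).
      by rewrite joinx1 neg1 neg0 !meetx1.
    by rewrite leIx2 // leIr orbT.
rewrite !lexI; apply/and3P; split.
- apply: le_trans _ (nu _ _); rewrite lexI; apply/andP; split.
    apply: le_trans _ (le_negneg _); apply: le_trans (leIr _ _) _; exact: leIl.
  by do 2 apply: le_trans (leIr _ _) _; exact: leIr.
- exact: le_trans (leIr _ _) (vi _ _ _ _).
- apply: le_trans _ (cl (v 0) (v 1) (v 2) (v 3)).
  by rewrite leI2 // leIl.
Qed.

(** For [Cl], involutive negation and De Morgan give excluded middle; in [Vi], [f] alone already
    bounds the premise. *)
Lemma ortholattice_Nu_Vi_Cl :
  ortholattice L -> validates L [set Nu; Vi; Cl]%classic.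
Proof.
move=> ortho e [[|]|] ->.
- by apply/validNuE => a b; rewrite !ortho.
- apply/validViE => a c e' f; rewrite ortho.
  by rewrite !lexUr // meetA leIr.
- apply/validClE => a b c e'; set u := b `&` (c `|` e').
  suff -> : u `|` neg u = \top by exact: lex1.
  by rewrite -[LHS]ortho negU meet_neg neg0.
Qed.

(** [Vi] is an instance of distributivity. For [Cl], distributivity makes the premise disjoint from
    [u], hence below [neg u]. *)
Lemma heyting_Nu_Vi_Cl :
  heyting_lattice L -> validates L [set Nu; Vi; Cl]%classic.
Proof.
move=> [meetUr pseudo] e [[|]|] ->.
- apply/validNuE => a b.
  (* Used on both [a] and [b], starting from the disjointness of [a], [b] and the negation of their
     meet. *)
  have negneg_disjoint x y : x `&` y = \bot -> neg (neg x) `&` y = \bot.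
    move=> /pseudo xy; apply/eqP.
    by rewrite -lex0 -(meet_neg (neg (neg x))) neg3 leI2.
  apply: (pseudo); rewrite meetCA; apply: (negneg_disjoint).
  rewrite meetA meetC; apply: (negneg_disjoint).
  by rewrite meetA [b `&` a]meetC meet_neg.
- apply/validViE => a c e' f.
  by rewrite meetA meetUr leIxl // joinA leUl.
- apply/validClE => a b c e'.
  rewrite lexUr // -meetUr; set u := b `&` (c `|` e'); apply: pseudo.
  by rewrite [_ `&` a]meetC meetA [u `&` a]meetC meet_neg.
Qed.

End FundamentalLattice.

(** * The ortholattice of regular elements *)

Definition regular d (L : fundLatticeType d) := {a : L | neg (neg a) == a}.

Section Regular.
Context {d : Order.disp_t} {L : fundLatticeType d}.
Implicit Types (a b : L) (x y z : regular L).

Lemma negnegK x : neg (neg (sval x)) = sval x.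
Proof. exact/eqP/(svalP x). Qed.

Lemma regularize_subproof a : neg (neg (neg (neg a))) == neg (neg a).
Proof. by rewrite neg3. Qed.

Definition regularize a : regular L :=
  exist (fun b => neg (neg b) == b) _ (regularize_subproof a).

Definition regular_le x y := sval x <= sval y.
(** For meets and negations [regularize] leaves the value unchanged, by [regularI] and [neg3]; a
    join of regular elements may fail to be regular. *)
Definition regular_meet x y := regularize (sval x `&` sval y).
Definition regular_join x y := regularize (sval x `|` sval y).
Definition regular_neg x := regularize (neg (sval x)).

Lemma regular_le_refl : reflexive regular_le.
Proof. by move=> x; rewrite /regular_le. Qed.

Lemma regular_le_anti : antisymmetric regular_le.
Proof. by move=> x y /le_anti; exact: val_inj. Qed.

Lemma regular_le_trans : transitive regular_le.
Proof. by move=> x y z; exact: le_trans. Qed.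

Lemma regular_lexI x y z :
  regular_le x (regular_meet y z) = regular_le x y && regular_le x z.
Proof. by rewrite /regular_le /= regularI ?negnegK // lexI. Qed.

Lemma regular_leUx x y z :
  regular_le (regular_join x y) z = regular_le x z && regular_le y z.
Proof. by rewrite /regular_le /= negneg_le_regular ?negnegK // leUx. Qed.

Lemma regular_le0x x : regular_le (regularize \bot) x.
Proof. by rewrite /regular_le /= negneg_le_regular ?negnegK // le0x. Qed.

Lemma regular_lex1 x : regular_le x (regularize \top).
Proof. by rewrite /regular_le /= neg1 neg0 lex1. Qed.

Lemma regular_neg_antitone x y :
  regular_le x y -> regular_le (regular_neg y) (regular_neg x).
Proof. by move=> xy; rewrite /regular_le /= !neg3 neg_antitone. Qed.

Lemma regular_meet_neg x : regular_meet x (regular_neg x) = regularize \bot.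
Proof. by apply: val_inj; rewrite /= neg3 meet_neg. Qed.

Lemma regular_negK x : regular_neg (regular_neg x) = x.
Proof. by apply: val_inj; rewrite /= !neg3 negnegK. Qed.

Lemma regular_le_negneg x : regular_le x (regular_neg (regular_neg x)).
Proof. by rewrite regular_negK; exact: regular_le_refl. Qed.

HB.instance Definition _ := Choice.on (regular L).
HB.instance Definition _ := Le_isFundamental.Build d (regular L)
  regular_le_refl regular_le_anti regular_le_trans regular_lexI regular_leUx
  regular_le0x regular_lex1 regular_neg_antitone regular_meet_neg
  regular_le_negneg.

Lemma regular_leE x y : (x <= y) = (sval x <= sval y).
Proof. by []. Qed.

Lemma regular_ortholattice : ortholattice (regular L).
Proof. exact: regular_negK. Qed.

(** [Nu] is what the meet case requires; joins and negations commute with double negation by [negU]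
    and [neg3]. *)
Lemma eval_regularize (v : nat -> L) p : valid L Nu ->
  sval (eval (regularize \o v) p) = neg (neg (eval v p)).
Proof.
move=> /validNuE nu; elim: p => //= [p IHp q IHq|p IHp q IHq|p IHp].
- rewrite IHp IHq regularI ?neg3 //; apply/le_anti.
  by rewrite nu lexI !le_negneg_mono ?leIl ?leIr.
- by rewrite IHp IHq !negU !neg3.
- by rewrite IHp !neg3.
Qed.

End Regular.

(** * The Heyting lattice of up-sets of a family of sets ordered by inclusion *)

Section Upset.
Context {T : Type} {K : set (set T)}.

Record upset := Upset {
  upset_set :> set T -> Prop;
  upset_sub : (upset_set `<=` K)%classic;
  upset_closed : forall F G, upset_set F -> K G -> (F `<=` G)%classic ->
    upset_set G }.

HB.instance Definition _ := gen_eqMixin upset.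
HB.instance Definition _ := gen_choiceMixin upset.

Implicit Types U V W : upset.

Lemma upset_eq U V : (forall F, U F <-> V F) -> U = V.
Proof.
case: U V => [U sU cU] [V sV cV] /= /predeqP UV.
by case: _ / UV in sV cV *; congr Upset; exact: Prop_irrelevance.
Qed.

Definition upset_le U V := `[< (U `<=` V)%classic >].

Program Definition upset_meet U V := @Upset (U `&` V)%classic _ _.
Next Obligation. by move=> U V F [/upset_sub]. Qed.
Next Obligation.
by move=> U V F G [UF VF] KG FG; split; exact: upset_closed FG.
Qed.

Program Definition upset_join U V := @Upset (U `|` V)%classic _ _.
Next Obligation. by move=> U V F [] /upset_sub. Qed.
Next Obligation.
by move=> U V F G [] H KG FG; [left|right]; exact: upset_closed FG.
Qed.

Program Definition upset_bot := @Upset set0 _ _.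
Next Obligation. by []. Qed.
Next Obligation. by []. Qed.

Program Definition upset_top := @Upset K _ _.
Next Obligation. by []. Qed.
Next Obligation. by []. Qed.

(** Kripke negation: no extension of [F] lies in [U]. Membership of [G] in [U] already entails
    [K G]. *)
Program Definition upset_neg U := @Upset
  [set F | K F /\ forall G, (F `<=` G)%classic -> ~ U G]%classic _ _.
Next Obligation. by move=> U F []. Qed.
Next Obligation.
move=> U F G [KF nF] KG FG; split=> // H GH; apply: nF.
exact: subset_trans GH.
Qed.

Lemma upset_le_refl : reflexive upset_le.
Proof. by move=> U; apply/asboolP. Qed.

Lemma upset_le_anti : antisymmetric upset_le.
Proof.
move=> U V /andP[/asboolP UV /asboolP VU].
by apply: upset_eq => F; split=> [/UV|/VU].
Qed.

Lemma upset_le_trans : transitive upset_le.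
Proof.
move=> V U W /asboolP UV /asboolP VW; apply/asboolP; exact: subset_trans VW.
Qed.

Lemma upset_lexI U V W :
  upset_le U (upset_meet V W) = upset_le U V && upset_le U W.
Proof.
by rewrite /upset_le -asbool_and; apply: asbool_equiv_eq; rewrite subsetI.
Qed.

Lemma upset_leUx U V W :
  upset_le (upset_join U V) W = upset_le U W && upset_le V W.
Proof.
by rewrite /upset_le -asbool_and; apply: asbool_equiv_eq; rewrite subUset.
Qed.

Lemma upset_le0x U : upset_le upset_bot U.
Proof. by apply/asboolP. Qed.

Lemma upset_lex1 U : upset_le U upset_top.
Proof. by apply/asboolP => F /upset_sub. Qed.

Lemma upset_neg_antitone U V :
  upset_le U V -> upset_le (upset_neg V) (upset_neg U).
Proof.
by move=> /asboolP UV; apply/asboolP => F [KF nF]; split=> // G /nF nVG /UV.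
Qed.

Lemma upset_pseudocomplement U V :
  upset_meet U V = upset_bot -> upset_le V (upset_neg U).
Proof.
move=> /(congr1 upset_set) /= UV0; apply/asboolP => F VF.
split=> [|G FG UG]; first exact: upset_sub VF.
have : (U `&` V)%classic G.
  by split=> //; apply: upset_closed FG => //; exact: upset_sub UG.
by rewrite UV0.
Qed.

Lemma upset_meet_neg U : upset_meet U (upset_neg U) = upset_bot.
Proof. by apply: upset_eq => F; split=> // -[UF [_ /(_ F)]]; exact. Qed.

Lemma upset_le_negneg U : upset_le U (upset_neg (upset_neg U)).
Proof.
apply: upset_pseudocomplement; rewrite -[RHS](upset_meet_neg U).
by apply: upset_eq => F; split=> -[].
Qed.

HB.instance Definition _ := Le_isFundamental.Build (Order.Disp tt tt) upset
  upset_le_refl upset_le_anti upset_le_trans upset_lexI upset_leUx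
  upset_le0x upset_lex1 upset_neg_antitone upset_meet_neg upset_le_negneg.

Lemma upset_heyting : heyting_lattice upset.
Proof.
split=> [U V W|]; last exact: upset_pseudocomplement.
by apply: upset_eq => F; cbn; tauto.
Qed.

End Upset.
Arguments upset {T} K.

(** * Prime filters: separation, extension and representation *)

Section PrimeFilter.
Context {d : Order.disp_t} {L : fundLatticeType d}.
Implicit Types (a b c x y : L) (F G : set L).

Record is_filter F : Prop := IsFilter {
  filter_top : F \top;
  filter_up : forall a b, F a -> a <= b -> F b;
  filter_meet : forall a b, F a -> F b -> F (a `&` b) }.

Record is_prime_filter F : Prop := IsPrimeFilter {
  prime_filter :> is_filter F;
  prime_bot : ~ F \bot;
  prime_join : forall a b, F (a `|` b) -> F a \/ F b }.

(** For a filter [F], this is the filter generated by [F] and [a]. *)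
Definition adjoin F a : set L :=
  [set b | exists2 c, F c & (c `&` a <= b)%O]%classic.

Lemma adjoin_filter F a : is_filter F -> is_filter (adjoin F a).
Proof.
move=> [F1 Fup FI]; split=> [|b c [e Fe eb] bc|b c [e Fe eb] [f Ff fc]].
- by exists \top.
- by exists e => //; exact: le_trans bc.
- exists (e `&` f); first exact: FI.
  rewrite lexI (le_trans _ eb) ?(le_trans _ fc) // leI2 //; first exact: leIr.
  exact: leIl.
Qed.

Lemma sub_adjoin F a : (F `<=` adjoin F a)%classic.
Proof. by move=> b Fb; exists b => //; exact: leIl. Qed.

Lemma mem_adjoin F a : is_filter F -> adjoin F a a.
Proof. by move=> [F1 _ _]; exists \top => //; exact: leIr. Qed.

Lemma maximal_filter F y : is_filter F -> ~ F y ->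
  exists G, [/\ is_filter G, (F `<=` G)%classic, ~ G y &
    forall c, ~ G c -> exists2 b, G b & b `&` c <= y].
Proof.
move=> filF Fy.
(* Zorn's lemma also concerns the empty chain, whose union is empty; taking the union with [F] makes
   that case the filter [F] itself. *)
pose P (A : set L) := is_filter (F `|` A)%classic /\ ~ (F `|` A)%classic y.
have [C CP Ctot|A [[filA Ay] Amax]] := @Zorn_bigcup L P.
  (* Since the chain is total, two members of the union already lie together in [F] or in one stage,
     so closure under meets is inherited. *)
  have two a b : (F `|` \bigcup_(X in C) X)%classic a ->
      (F `|` \bigcup_(X in C) X)%classic b ->
    (F a /\ F b) \/ exists2 X, C X & (F `|` X)%classic a /\ (F `|` X)%classic b.
    move=> [Fa|[X CX Xa]] [Fb|[Y CY Yb]]; first by left.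
    - by right; exists Y => //; split; [left|right].
    - by right; exists X => //; split; [right|left].
    - have [XY|YX] := Ctot X Y CX CY.
      + by right; exists Y => //; split; right => //; exact: XY.
      + by right; exists X => //; split; right => //; exact: YX.
  have incl X : C X -> (F `|` X `<=` F `|` \bigcup_(X in C) X)%classic.
    by move=> CX z [Fz|Xz]; [left|right; exists X].
  split; first split.
  - by left; exact: filter_top.
  - move=> a b Ha ab; have [[Fa _]|[X CX [Xa _]]] := two a a Ha Ha.
      by left; exact: filter_up ab.
    by apply: (incl X CX); apply: filter_up ab => //; exact: (CP X CX).1.
  - move=> a b Ha Hb; have [[Fa Fb]|[X CX [Xa Xb]]] := two a b Ha Hb.
      by left; exact: filter_meet.
    by apply: (incl X CX); apply: filter_meet => //; exact: (CP X CX).1.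
  - by move=> [//|[X CX Xy]]; apply: (CP X CX).2; right.
exists (F `|` A)%classic; split=> // c Ac.
apply: contrapT => nex.
(* Otherwise adjoining [c] would give a strictly larger filter still omitting [y]. *)
have FA : (F `|` adjoin (F `|` A) c = adjoin (F `|` A) c)%classic.
  by apply/setUidPr => z Fz; apply: sub_adjoin; left.
apply: (Amax (adjoin (F `|` A) c)%classic).
  split=> [z Az|/(_ c (mem_adjoin c filA)) Ac'].
    by apply: sub_adjoin; right.
  by apply: Ac; right.
by split; rewrite FA //; exact: adjoin_filter.
Qed.

(** [Vi] is distributivity below the double negation of [y], up to joining [y]; this is enough for a
    filter maximal among those omitting [y] to be prime. *)
Lemma prime_separation x y : valid L Vi ->
  x <= neg (neg y) -> ~~ (x <= y) ->
  exists F, [/\ is_prime_filter F, F x & ~ F y].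
Proof.
move=> /validViE vi xy /negP nxy.
have [|//|F [filF xF Fy Fmax]] := @maximal_filter [set z | x <= z]%classic y.
  split=> /= [|a b|a b]; [exact: lex1|exact: le_trans|].
  by rewrite lexI => -> ->.
have Fx : F x by apply: xF => /=.
exists F; split=> //; split=> // [F0|a b Fab].
  by apply: Fy; apply: filter_up F0 _ => //; exact: le0x.
apply: contrapT => /not_orP[/Fmax[e Fe ea] /Fmax[f Ff fb]].
have [g [Fg gx ge gf]] : exists g, [/\ F g, g <= x, g <= e & g <= f].
  exists (x `&` (e `&` f)); split; first by do ![apply: filter_meet => //].
  - exact: leIl.
  - by rewrite leIxr // leIl.
  - by rewrite leIxr // leIr.
apply: Fy; apply: (filter_up filF (filter_meet filF Fg Fab)).
(* Since [g] is below [x], the factor [neg (neg y)] can be inserted to match the premise of [Vi]. *)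
have -> : g `&` (a `|` b) = g `&` ((a `|` b) `&` neg (neg y)).
  by rewrite meetA; apply/esym/meet_l; rewrite leIxl // (le_trans gx).
apply: le_trans (vi _ _ _ _) _; rewrite !leUx lexx andbT.
by rewrite (le_trans _ ea) ?(le_trans _ fb) // leI2.
Qed.

(** [Cl] puts [b] below the join of [a] and [neg a]; primality then chooses [neg a], as [a] would
    make [F] improper. *)
Lemma filter_disjoint_neg F a b : valid L Cl -> is_prime_filter F ->
  F b -> b `&` a = \bot -> F (neg a).
Proof.
move=> /validClE cl pF Fb ba0.
have := cl b a a a; rewrite !joinxx meetxx ba0 neg0 meet1x => h.
have [Fa|//] := prime_join pF (filter_up pF Fb h).
by case: (prime_bot pF); rewrite -ba0; exact: (filter_meet pF).
Qed.

(** Primality of the maximal [G] is transferred from [F]: [Cl] supplies an instance of excluded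
    middle that [F], being prime, must decide. *)
Lemma prime_extension F a : valid L Cl -> is_prime_filter F -> ~ F (neg a) ->
  exists G, [/\ is_prime_filter G, (F `<=` G)%classic & G a].
Proof.
move=> vcl pF Fna; have /validClE cl := vcl.
have [||G [filG FG G0 Gmax]] := @maximal_filter (adjoin F a) \bot.
- exact: adjoin_filter pF.
- move=> [b Fb]; rewrite lex0 => /eqP ba0.
  by apply: Fna; exact: filter_disjoint_neg Fb ba0.
exists G; split; last 2 first.
- by move=> z Fz; apply/FG/sub_adjoin.
- exact: FG (mem_adjoin a pF).
split=> // b c Gbc; apply: contrapT => /not_orP[/Gmax[e Ge eb] /Gmax[f Gf fc]].
move: eb fc; rewrite !lex0 => /eqP eb /eqP fc.
pose g := e `&` f; pose u := g `&` (b `|` c).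
have Gu : G u by do ![apply: filter_meet => //].
have gb : g `&` b = \bot by rewrite /g meetAC eb meet0x.
have gc : g `&` c = \bot by rewrite /g -meetA fc meetx0.
(* As [g] is disjoint from both [b] and [c], the negated premise of [Cl] at [\top] is [\top]. *)
have : F (u `|` neg u).
  apply: (filter_up pF (filter_top pF)).
  have := cl \top g b c; rewrite gb gc joinxx meetx0 neg0 meet1x; exact.
(* If [u] is in [F], so is [b] or [c], contradicting [e] or [f] in [G]; if [neg u] is in [F], it
   meets [u] in [G]. *)
move=> /(prime_join pF) [Fu|/(sub_adjoin a)/FG Gnu].
  have : F (b `|` c) by apply: (filter_up pF Fu); exact: leIr.
  move=> /(prime_join pF)[]/(sub_adjoin a)/FG H; apply: G0.
    by rewrite -eb; exact: filter_meet.
  by rewrite -fc; exact: filter_meet.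
by apply: G0; rewrite -(meet_neg u); exact: filter_meet.
Qed.

Program Definition prime_upset a : upset is_prime_filter :=
  @Upset _ _ [set F | is_prime_filter F /\ F a]%classic _ _.
Next Obligation. by move=> a F []. Qed.
Next Obligation. by move=> a F G [_ Fa] pG FG; split=> //; exact: FG. Qed.

(** Meets use the filter laws, joins primality, and negation [prime_extension], which finds a prime
    extension containing [p] when [neg p] is missing. *)
Lemma eval_prime_upset (v : nat -> L) p : valid L Cl ->
  eval (prime_upset \o v) p = prime_upset (eval v p).
Proof.
move=> cl.
elim: p => //= [||p -> q ->|p -> q ->|p ->]; apply: upset_eq => F; cbn.
- by split=> [pF|[]//]; split=> //; exact: (filter_top pF).
- by split=> // -[pF /(prime_bot pF)].
- split=> [[[pF Fp] [_ Fq]]|[pF Fpq]].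
    by split=> //; exact: (filter_meet pF).
  by split; split=> //; apply: (filter_up pF Fpq); rewrite ?leIl ?leIr.
- split=> [[][pF H]|[pF /(prime_join pF)[]]]; [split=> //..|by left|by right].
    by apply: (filter_up pF H); exact: leUl.
  by apply: (filter_up pF H); exact: leUr.
- split=> -[pF H]; split=> //.
    apply: contrapT => /(prime_extension cl pF)[G [pG FG Gp]].
    exact: H FG _.
  move=> G FG [pG Gp]; apply: (prime_bot pG); rewrite -(meet_neg (eval v p)).
  by apply: (filter_meet pG) => //; exact: FG.
Qed.

End PrimeFilter.

(** * Axiomatization of the intersection of the two logics *)

Lemma Nu_Vi_Cl_complete : axiomatizes [set Nu; Vi; Cl]%classic
  (orthologic `&` intuitionistic_fragment)%classic.
Proof.
apply/seteqP; split=> e.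
  move=> h; split=> d L hL; apply: h.
    exact: ortholattice_Nu_Vi_Cl.
  exact: heyting_Nu_Vi_Cl.
move=> [ortho int] d L hL v; apply: contrapT => /negP npq.
have nu : valid L Nu by apply: hL; left; left.
have vi : valid L Vi by apply: hL; left; right.
have cl : valid L Cl by apply: hL; right.
(* Orthologic places the premise below the double negation of the conclusion, as [prime_separation]
   requires. *)
have := ortho _ _ (@regular_ortholattice _ L) (regularize \o v).
rewrite regular_leE !eval_regularize // negneg_le_regular ?neg3 //.
move=> /(prime_separation vi)/(_ npq)[F [pF Fp Fq]].
(* The prime filter [F] is a point of the up-set of the premise outside that of the conclusion. *)
have := int _ _ (@upset_heyting L is_prime_filter) (prime_upset \o v).
rewrite !eval_prime_upset // => /asboolP/(_ F)[//|_].
exact: Fq.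
Qed.

(** * Finite models checked by computation *)

(* [rank] lists the positions of 0, ..., n - 1 in a second linear order; a point
   is below another when it precedes it in both orders (all the lattices needed
   below have order dimension 2).  Hence the points 0 and n - 1 are the bounds,
   and a meet is found as the last common lower bound. *)
Section FiniteModel.
Context (rank ng : seq nat).
Local Notation n := (size rank).
Implicit Types (x y : 'I_n) (P : nat -> bool).

Definition fin_all P := all P (iota 0 n).
Definition fin_le i j := (i <= j)%N && (nth 0 rank i <= nth 0 rank j)%N.
Definition fin_meet i j :=
  last 0 [seq k <- iota 0 n | fin_le k i && fin_le k j].
Definition fin_join i j :=
  head 0 [seq k <- iota 0 n | fin_le i k && fin_le j k].
Definition fin_neg i := nth 0 ng i.

(** Everything is computed on natural numbers, so the test evaluates to a boolean; it also verifies
    that the bounds found by [fin_meet] and [fin_join] are the greatest lower and least upper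
    ones. *)
Definition is_fin_fundamental :=
  [&& (0 < n)%N,
  fin_all (fun i => [&& (fin_neg i < n)%N, fin_le 0 i, fin_le i n.-1,
    fin_meet i (fin_neg i) == 0 & fin_le i (fin_neg (fin_neg i))]) &
  fin_all (fun i => fin_all (fun j =>
    [&& (fin_meet i j < n)%N, (fin_join i j < n)%N,
      fin_le i j ==> fin_le (fin_neg j) (fin_neg i) &
    fin_all (fun k =>
      (fin_le i (fin_meet j k) == fin_le i j && fin_le i k) &&
      (fin_le (fin_join i j) k == fin_le i k && fin_le j k))]))].

Lemma fin_allP P : reflect (forall x, P x) (fin_all P).
Proof.
apply: (iffP allP) => [h x|h i]; first by rewrite h // mem_iota ltn_ord.
by rewrite mem_iota => ltin; exact: (h (Ordinal ltin)).
Qed.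

Context (ok : is_fin_fundamental).

(** The proof of the test is a parameter of the type, so that the lattice structure can be attached
    to it. *)
Definition fin_carrier of is_fin_fundamental := 'I_n.
Local Notation T := (fin_carrier ok).

Lemma fin_gt0 : (0 < n)%N. Proof. by case/and3P: ok. Qed.

Lemma fin_pointP x : [&& (fin_neg x < n)%N, fin_le 0 x, fin_le x n.-1,
  fin_meet x (fin_neg x) == 0 & fin_le x (fin_neg (fin_neg x))].
Proof. by have /and3P[_ /fin_allP] := ok. Qed.

Lemma fin_pairP x y : [&& (fin_meet x y < n)%N, (fin_join x y < n)%N,
  fin_le x y ==> fin_le (fin_neg y) (fin_neg x) &
  fin_all (fun k =>
    (fin_le x (fin_meet y k) == fin_le x y && fin_le x k) &&
    (fin_le (fin_join x y) k == fin_le x k && fin_le y k))].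
Proof. by have /and3P[_ _ /fin_allP/(_ x)/fin_allP] := ok. Qed.

Lemma fin_neg_lt x : (fin_neg x < n)%N.
Proof. by case/and5P: (fin_pointP x). Qed.

Lemma fin_meet_lt x y : (fin_meet x y < n)%N.
Proof. by case/and4P: (fin_pairP x y). Qed.

Lemma fin_join_lt x y : (fin_join x y < n)%N.
Proof. by case/and4P: (fin_pairP x y). Qed.

Lemma fin_top_lt : (n.-1 < n)%N.
Proof. by rewrite prednK ?fin_gt0. Qed.

Definition ord_le : rel 'I_n := fun x y => fin_le x y.
Definition ord_meet x y : 'I_n := Ordinal (fin_meet_lt x y).
Definition ord_join x y : 'I_n := Ordinal (fin_join_lt x y).
Definition ord_neg x : 'I_n := Ordinal (fin_neg_lt x).
Definition ord_bot : 'I_n := Ordinal fin_gt0.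
Definition ord_top : 'I_n := Ordinal fin_top_lt.

Lemma ord_le_refl : reflexive ord_le.
Proof. by move=> x; rewrite /ord_le /fin_le !leqnn. Qed.

Lemma ord_le_anti : antisymmetric ord_le.
Proof.
move=> x y /andP[/andP[xy _] /andP[yx _]]; apply/val_inj/eqP.
by rewrite eqn_leq xy.
Qed.

Lemma ord_le_trans : transitive ord_le.
Proof.
move=> y x z /andP[xy rxy] /andP[yz ryz].
by rewrite /ord_le /fin_le (leq_trans xy yz) (leq_trans rxy ryz).
Qed.

Lemma ord_lexI x y z : ord_le x (ord_meet y z) = ord_le x y && ord_le x z.
Proof. by have /and4P[_ _ _ /fin_allP/(_ z)/andP[/eqP]] := fin_pairP x y. Qed.

Lemma ord_leUx x y z : ord_le (ord_join x y) z = ord_le x z && ord_le y z.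
Proof. by have /and4P[_ _ _ /fin_allP/(_ z)/andP[_ /eqP]] := fin_pairP x y. Qed.

Lemma ord_le0x x : ord_le ord_bot x.
Proof. by case/and5P: (fin_pointP x). Qed.

Lemma ord_lex1 x : ord_le x ord_top.
Proof. by case/and5P: (fin_pointP x). Qed.

Lemma ord_neg_antitone x y : ord_le x y -> ord_le (ord_neg y) (ord_neg x).
Proof. by have /and4P[_ _ /implyP] := fin_pairP x y. Qed.

Lemma ord_meet_neg x : ord_meet x (ord_neg x) = ord_bot.
Proof. by apply/val_inj/eqP; case/and5P: (fin_pointP x). Qed.

Lemma ord_le_negneg x : ord_le x (ord_neg (ord_neg x)).
Proof. by case/and5P: (fin_pointP x). Qed.

HB.instance Definition _ := Choice.on T.
HB.instance Definition _ := Le_isFundamental.Build (Order.Disp tt tt) T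
  ord_le_refl ord_le_anti ord_le_trans ord_lexI ord_leUx ord_le0x ord_lex1
  ord_neg_antitone ord_meet_neg ord_le_negneg.

(** The operations of [T] unfold to those on natural numbers, which turns validity into a boolean
    computation. *)
Lemma fin_validNuE : valid T Nu <->
  fin_all (fun a => fin_all (fun b =>
    fin_le (fin_meet (fin_neg (fin_neg a)) (fin_neg (fin_neg b)))
      (fin_neg (fin_neg (fin_meet a b))))).
Proof.
rewrite validNuE; split=> [h|/fin_allP h a b].
  by apply/fin_allP => a; apply/fin_allP => b; exact: h.
by have /fin_allP := h a; exact.
Qed.

Lemma fin_validViE : valid T Vi <->
  fin_all (fun a => fin_all (fun c => fin_all (fun e => fin_all (fun f =>
    fin_le (fin_meet a (fin_meet (fin_join c e) (fin_neg (fin_neg f))))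
      (fin_join (fin_meet a c) (fin_join (fin_meet a e) f)))))).
Proof.
rewrite validViE; split=> [h|/fin_allP h a c e f].
  do 4 (apply/fin_allP => ?); exact: h.
by have /fin_allP/(_ c)/fin_allP/(_ e)/fin_allP := h a; exact.
Qed.

Lemma fin_validClE : valid T Cl <->
  fin_all (fun a => fin_all (fun b => fin_all (fun c => fin_all (fun e =>
    let u := fin_meet b (fin_join c e) in
    let t := fin_join (fin_meet b c) (fin_meet b e) in
    fin_le (fin_meet (fin_neg (fin_meet a t)) a)
      (fin_join u (fin_neg u)))))).
Proof.
rewrite validClE; split=> [h|/fin_allP h a b c e].
  do 4 (apply/fin_allP => ?); exact: h.
by have /fin_allP/(_ b)/fin_allP/(_ c)/fin_allP := h a; exact.
Qed.

End FiniteModel.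

(** * Independence of the three axioms *)

(* The chains 0 < 1 < 2 < 4 < 7 and 0 < 3 < 5 < 6 < 7 together with 3 < 4;
   Nu fails at 6 and 4. *)
Lemma Vi_Cl_not_Nu : ~ fund_implies [set Vi; Cl]%classic Nu.
Proof.
have ok : is_fin_fundamental [:: 0; 4; 5; 1; 6; 2; 3; 7]
  [:: 7; 6; 5; 2; 0; 2; 1; 0] by vm_compute.
move=> /(_ _ (fin_carrier ok)) H.
have /H/fin_validNuE : validates (fin_carrier ok) [set Vi; Cl]%classic.
  by move=> e [->|->]; [apply/fin_validViE|apply/fin_validClE]; vm_compute.
by vm_compute.
Qed.

(* The pentagon 0 < 1 < 4, 0 < 2 < 3 < 4. *)
Lemma Nu_Cl_not_Vi : ~ fund_implies [set Nu; Cl]%classic Vi.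
Proof.
have ok : is_fin_fundamental [:: 0; 3; 1; 2; 4] [:: 4; 3; 1; 1; 0]
  by vm_compute.
move=> /(_ _ (fin_carrier ok)) H.
have /H/fin_validViE : validates (fin_carrier ok) [set Nu; Cl]%classic.
  by move=> e [->|->]; [apply/fin_validNuE|apply/fin_validClE]; vm_compute.
(* A failing instance of [Vi] is [a = 3], [c = 2], [e = 1], [f = 2]. *)
by vm_compute.
Qed.

(* Four atoms 1, 2, 3, 4 with pairwise join 5, below a new top 6. *)
Lemma Nu_Vi_not_Cl : ~ fund_implies [set Nu; Vi]%classic Cl.
Proof.
have ok : is_fin_fundamental [:: 0; 4; 3; 2; 1; 5; 6]
  [:: 6; 2; 1; 4; 3; 0; 0] by vm_compute.
move=> /(_ _ (fin_carrier ok)) H.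
have /H/fin_validClE : validates (fin_carrier ok) [set Nu; Vi]%classic.
  by move=> e [->|->]; [apply/fin_validNuE|apply/fin_validViE]; vm_compute.
(* A failing instance of [Cl] is [a = 6], [b = 1], [c = 2], [d = 3]. *)
by vm_compute.
Qed.

Theorem theorem5p3 :
  (forall (d : Order.disp_t) (L : fundLatticeType d),
     valid L Ex <-> [/\ valid L Nu, valid L Vi & valid L Cl]) /\
  axiomatizes [set Nu; Vi; Cl]%classic
    (orthologic `&` intuitionistic_fragment)%classic /\
  [/\ ~ fund_implies [set Vi; Cl]%classic Nu,
      ~ fund_implies [set Nu; Cl]%classic Vi
    & ~ fund_implies [set Nu; Vi]%classic Cl].
Proof.
split; first by move=> d L; exact: validEx.
split; first exact: Nu_Vi_Cl_complete.
split; [exact: Vi_Cl_not_Nu|exact: Nu_Cl_not_Vi|exact: Nu_Vi_not_Cl].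
Qed.
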